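(* Let $(C(t))_{t\in\mathbb{R}}$ be a strongly continuous cosine family on a UMD-space $X$ such that $$\limsup_{t\downarrow0}\|C(t)-\mathrm{Id}\|<2.$$ Then $(C(t))_{t\in\mathbb{R}}$ is uniformly continuous (i.e. $t\mapsto C(t)$ is continuous for the operator norm) and $\limsup_{t\downarrow0}\|C(t)-\mathrm{Id}\|=0$.
   Context: Banach spaces are complex. A strongly continuous cosine family on a Banach space $X$ is a strongly continuous map $C:\mathbb{R}\to\mathcal{L}(X)$ with $C(0)=\mathrm{Id}$ and $2C(t)C(s)=C(t+s)+C(t-s)$ for all $t,s\ge0$. *)

(* Defs.v *)
(* The complex numbers are [R[i]], for an arbitrary [R : realType]. *)
From HB Require Import structures.
From mathcomp Require Export all_boot all_order all_algebra.
From mathcomp Require Export complex.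
From mathcomp Require Export all_classical all_reals all_analysis.

Set Implicit Arguments.
Unset Strict Implicit.
Unset Printing Implicit Defensive.

Import Order.TTheory GRing.Theory Num.Theory.
Import numFieldTopology.Exports numFieldNormedType.Exports.

Local Open Scope classical_set_scope.
Local Open Scope ring_scope.

(* The norm of a normed module over [R[i]] takes its values in [R[i]] and is a
   nonnegative real there; [rnorm] is the same number, read in [R]. *)
Definition rnorm (R : realType) (X : normedModType R[i]) (x : X) : R :=
  complex.Re `|x|.

Definition opnorm (R : realType) (X : normedModType R[i]) (T : X -> X) :
    \bar R :=
  ereal_sup [set (rnorm (T x))%:E | x in [set x : X | rnorm x <= 1]].

(* The values of [C] lie in L(X): the type gives linearity, [cosine_bounded]
   boundedness. *)
Record cosine_family (R : realType) (X : normedModType R[i])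
    (C : R -> {linear X -> X}) : Prop := CosineFamily {
  cosine_bounded : forall t, continuous (C t : X -> X) ;
  cosine0 : forall x, C 0 x = x ;
  cosineD : forall t s, 0 <= t -> 0 <= s -> forall x,
    2 *: C t (C s x) = C (t + s) x + C (t - s) x
}.

Definition strongly_continuous (R : realType) (X : normedModType R[i])
    (C : R -> {linear X -> X}) : Prop :=
  forall x : X, continuous (fun t : R => C t x : X).

Definition uniformly_continuous (R : realType) (X : normedModType R[i])
    (C : R -> {linear X -> X}) : Prop :=
  forall t : R, opnorm (fun x => C s x - C t x) @[s --> t] --> 0%E.

Definition simple_wrt (T : Type) (R : realType) (X : normedModType R[i])
    (F : set (set T)) (s : T -> X) : Prop :=
  finite_set (range s) /\ forall x, F (s @^-1` [set x]).

Definition strongly_measurable_wrt (T : Type) (R : realType)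
    (X : normedModType R[i]) (F : set (set T)) (f : T -> X) : Prop :=
  exists s : nat -> T -> X, (forall k, simple_wrt F (s k)) /\
    forall w, s k w @[k --> \oo] --> f w.

Definition simple_integral (d : measure_display) (T : measurableType d)
    (R : realType) (P : probability T R) (X : normedModType R[i])
    (A : set T) (s : T -> X) : X :=
  \sum_(x \in range s) ((fine (P (A `&` s @^-1` [set x])))%:C)%C *: x.

Definition is_bochner_integral (d : measure_display) (T : measurableType d)
    (R : realType) (P : probability T R) (X : normedModType R[i])
    (A : set T) (f : T -> X) (v : X) : Prop :=
  strongly_measurable_wrt measurable f /\
  exists s : nat -> T -> X,
    [/\ forall k, simple_wrt measurable (s k),
        (\int[P]_(w in A) (rnorm (f w - s k w))%:E)%E @[k --> \oo] --> 0%E &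
        simple_integral P A (s k) @[k --> \oo] --> v].

Definition bochner_Lnorm (d : measure_display) (T : measurableType d)
    (R : realType) (P : probability T R) (X : normedModType R[i])
    (p : R) (f : T -> X) : \bar R :=
  Lnorm P p%:E (fun w => (rnorm (f w))%:E).

Definition filtration (d : measure_display) (T : measurableType d)
    (F : nat -> set (set T)) : Prop :=
  [/\ forall n, sigma_algebra setT (F n),
      forall n, F n `<=` measurable &
      forall n, F n `<=` F n.+1].

(* [f 0, ..., f N] is a martingale in L^p(P; X): the last condition says that
   the conditional expectation of [f n.+1] given [F n] is [f n]. *)
Record Lp_martingale (d : measure_display) (T : measurableType d)
    (R : realType) (P : probability T R) (X : normedModType R[i]) (p : R)
    (N : nat) (F : nat -> set (set T)) (f : nat -> T -> X) : Prop :=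
  LpMartingale {
  martingale_adapted : forall n, (n <= N)%N ->
    strongly_measurable_wrt (F n) (f n) ;
  martingale_Lp : forall n, (n <= N)%N ->
    (bochner_Lnorm P p (f n) < +oo)%E ;
  martingale_condexp : forall n, (n < N)%N -> forall A, F n A ->
    exists v, is_bochner_integral P A (f n) v /\
              is_bochner_integral P A (f n.+1) v
}.

Definition martingale_diff (T : Type) (R : realType) (X : normedModType R[i])
    (f : nat -> T -> X) (n : nat) : T -> X :=
  if n is m.+1 then fun w => f m.+1 w - f m w else f 0%N.

(* The signs are the [(-1) ^+ eps n]; the initial term [f 0] is counted as the
   first martingale difference. *)
Definition UMD (R : realType) (X : normedModType R[i]) : Prop :=
  forall p : R, 1 < p -> exists beta : R, 0 <= beta /\
    forall (d : measure_display) (T : measurableType d) (P : probability T R)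
      (N : nat) (F : nat -> set (set T)) (f : nat -> T -> X)
      (eps : nat -> bool),
    filtration F -> Lp_martingale P p N F f ->
    (bochner_Lnorm P p
       (fun w => \sum_(n < N.+1) (-1) ^+ eps n *: martingale_diff f n w)%R
     <= beta%:E * bochner_Lnorm P p
       (fun w => \sum_(n < N.+1) martingale_diff f n w)%R)%E.

(* Main.v *)
(* Since [1 - cos] takes the value 2, the constant Fourier coefficient
   ['C(2n, n) / 2 ^ n] of [(1 - cos) ^ n] exceeds [r ^ n] for large [n] as soon as
   [r < 2].  Accordingly [(1 - C s) ^ n] is ['C(2n, n) / 2 ^ n] times the identity
   plus a combination of the [C (k s)], [1 <= k <= n].  Averaging over [m] equally
   spaced points [s = i a] of [[0, d]], where [|C s - 1| <= r], and applying the
   result to [y = C (t + u) x - C t x] with [u = n! a], the addition formula makes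
   each average of [C (k i a) y] telescope, so that it is [O(1 / m)].  Hence
   [('C(2n, n) / 2 ^ n - r ^ n) |y| = O(1 / m) |x|], which tends to [0] as [u] does
   (with [m a <= d]), locally uniformly in [t]. *)
Require Import Defs.
From mathcomp Require Import ring lra zify.

Set Implicit Arguments.
Unset Strict Implicit.
Unset Printing Implicit Defensive.

Import Order.TTheory GRing.Theory Num.Theory.
Import numFieldTopology.Exports numFieldNormedType.Exports.
Local Open Scope classical_set_scope.
Local Open Scope ring_scope.

(** * The norm with real values *)

Section RealNorm.
Variables (R : realType) (X : normedModType R[i]).
Implicit Types (x y : X) (a : R) (n : nat).

Lemma rnormE x : (rnorm x)%:C%C = `|x|.
Proof. exact/RRe_real/normr_real. Qed.

Lemma rnorm_ge0 x : 0 <= rnorm x.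
Proof. by rewrite -lecR rnormE normr_ge0. Qed.

Lemma rnorm0 : rnorm (0 : X) = 0.
Proof. by rewrite /rnorm normr0. Qed.

Lemma rnormN x : rnorm (- x) = rnorm x.
Proof. by rewrite /rnorm normrN. Qed.

Lemma ler_rnormD x y : rnorm (x + y) <= rnorm x + rnorm y.
Proof. by rewrite -lecR rmorphD /= !rnormE ler_normD. Qed.

Lemma ler_rnormB x y : rnorm (x - y) <= rnorm x + rnorm y.
Proof. by rewrite -(rnormN y) ler_rnormD. Qed.

Lemma rnormMn x n : rnorm (x *+ n) = n%:R * rnorm x.
Proof.
by apply: complexI; rewrite rmorphM /= rmorph_nat !rnormE normrMn mulr_natl.
Qed.

Lemma rnorm_sign x n : rnorm ((-1) ^+ n *: x) = rnorm x.
Proof. by rewrite /rnorm normrZ normrX normrN1 expr1n mul1r. Qed.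

Lemma rnormZ a x : 0 <= a -> rnorm (a%:C%C *: x) = a * rnorm x.
Proof.
move=> a0; apply: complexI.
by rewrite rmorphM /= !rnormE normrZ ger0_norm // ler0c.
Qed.

Lemma rnorm_eq0 x : rnorm x = 0 -> x = 0.
Proof. by move=> x0; apply/eqP; rewrite -normr_eq0 -rnormE x0. Qed.

Lemma ler_rnorm_sum (I : Type) (s : seq I) (P : pred I) (F : I -> X) :
  rnorm (\sum_(i <- s | P i) F i) <= \sum_(i <- s | P i) rnorm (F i).
Proof.
elim/big_rec2: _ => [|i a x _ le_xa]; first by rewrite rnorm0.
by rewrite (le_trans (ler_rnormD _ _)) ?lerD2l.
Qed.

End RealNorm.

(** * Growth of the central binomial coefficients *)

Lemma central_bin_ge n : (4 ^ n <= n.*2.+1 * 'C(n.*2, n))%N.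
Proof.
elim: n => // n IHn.
have E1 := mul_bin_diag n.*2.+2 n; have E2 := mul_bin_down n.*2.+1 n.
rewrite /= in E1 E2; rewrite doubleS expnS.
have {}E2 : (n.*2.+1 * 'C(n.*2, n) = n.+1 * 'C(n.*2.+1, n))%N.
  by rewrite E2; congr (_ * _)%N; lia.
(* Passing from [n] to [n.+1] multiplies the central coefficient by [2 (2n + 1) / (n + 1)]; what
   remains is [4 (n + 1) <= 2 (2n + 3)]. *)
have E : (n.+1 * 'C(n.*2.+2, n.+1) = 2 * (n.*2.+1 * 'C(n.*2, n)))%N by rewrite E2 -E1; lia.
rewrite -(@leq_pmul2l n.+1) // [leqRHS]mulnCA E !mulnA.
by rewrite -[leqRHS]mulnA leq_mul //; lia.
Qed.

Lemma bernoulli_ineq (R : realDomainType) (x : R) n :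
  0 <= x -> 1 + n%:R * x <= (1 + x) ^+ n.
Proof.
move=> x0; elim: n => [|n IHn]; first by rewrite mul0r addr0.
have := ler_wpM2l (addr_ge0 ler01 x0) IHn; rewrite exprS; apply: le_trans.
rewrite -natr1 -subr_ge0.
by have -> : (1 + x) * (1 + n%:R * x) - (1 + (n%:R + 1) * x) = n%:R * x ^+ 2;
  [ring | rewrite mulr_ge0 ?sqr_ge0].
Qed.

(** With [x = 1 - r / 2] one has [2 r = 4 (1 - x)], and by [central_bin_ge] at [2k] it is enough
    that [(4k + 1) (1 - x) ^ 2k < 1]. Since [(1 - x) (1 + x) <= 1], this follows from
    [4k + 1 < (1 + x) ^ 2k]. *)
Lemma exists_central_bin_gt (R : realType) (r : R) : 0 <= r -> r < 2 ->
  exists n, (2 * r) ^+ n < 'C(n.*2, n)%:R.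
Proof.
move=> r0 r2; set x := 1 - r / 2.
have x0 : 0 < x by rewrite /x; lra.
have x1 : x <= 1 by rewrite /x; lra.
pose k := (Num.trunc (4 / x ^+ 2)).+1.
have kx : 4 < k%:R * x ^+ 2.
  by rewrite -ltr_pdivrMr ?exprn_gt0 //; exact: truncnS_gt.
exists k.*2.
have kk : 0 < (k.*2.*2.+1)%:R :> R by rewrite ltr0n.
rewrite -(ltr_pM2l kk) -natrM; apply: lt_le_trans (_ : (4 ^ k.*2)%:R <= _); last first.
  by rewrite ler_nat central_bin_ge.
have -> : 2 * r = 4 * (1 - x) by rewrite /x; field.
rewrite exprMn mulrCA -natrX -[ltRHS]mulr1 ltr_pM2l ?ltr0n ?expn_gt0 //.
have x1k : 0 < (1 + x) ^+ k.*2 by rewrite exprn_gt0 //; lra.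
rewrite -(ltr_pM2r x1k) mul1r -mulrA -exprMn.
apply: le_lt_trans (_ : k.*2.*2.+1%:R < _).
  rewrite ler_piMr // exprn_ile1 //; first by rewrite mulr_ge0 //; lra.
  by have := sqr_ge0 x; nra.
(* Bernoulli for the [k]-th power is only linear in [k]; its square contains [(k x) ^ 2], which
   exceeds [4k] by the choice of [k]. *)
rewrite -(addnn k) exprD; have := bernoulli_ineq k (ltW x0).
have k1 : 1 <= k%:R :> R by rewrite ler1n.
rewrite -(addn1 _.*2) -addnn !natrD.
set a := _ ^+ k; set c : R := k%:R => H.
have : 4 * c < (c * x) ^+ 2 by rewrite exprMn; nra.
by have := mulr_ge0 (ler0n R k) (ltW x0); rewrite -/c; nra.
Qed.

(** * Iterated finite differences *)

Section AlternatingBinomialSums.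
Variables (K : pzRingType) (V : lmodType K).
Implicit Types (g : nat -> V) (n m l : nat).

(** The value at 0 of [(1 - E) ^ n g], where [E] is the shift [g |-> g \o S]. *)
Definition altbin n g : V := \sum_(j < n.+1) (-1) ^+ j *: (g j *+ 'C(n, j)).

Lemma altbinS n g : altbin n.+1 g = altbin n g - altbin n (g \o S).
Proof.
rewrite /altbin big_ord_recl /= [X in _ = X - _]big_ord_recl /= !bin0 -addrA.
congr (_ + _).
under eq_bigr do rewrite binS mulrnDr scalerDr.
rewrite big_split /= -sumrN; congr (_ + _).
  by rewrite big_ord_recr /= bin_small // mulr0n scaler0 addr0.
by apply: eq_bigr => i _; rewrite exprS mulN1r scaleNr.
Qed.

(** This is [(1 - E) ^ 2 = 1 - 2 E + E ^ 2]; on translates of a cosine family the addition formula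
    turns this second difference into a factor [2 (C s - 1)]. *)
Lemma altbinSS n g :
  altbin n.+2 g = altbin n (fun j => g j - g j.+1 *+ 2 + g j.+2).
Proof.
rewrite !altbinS /altbin -!sumrB; apply: eq_bigr => i _ /=.
by rewrite -!scalerBr -!mulrnBl opprD opprK mulr2n opprD !addrA.
Qed.

(** Both sides become the sum over [i < m + l] once the first [m] and the first [l] terms are added.
    A sum of [m] increments thus reduces to [l] of them. *)
Lemma sum_shiftB m l g :
  \sum_(i < m) (g (l + i)%N - g i) = \sum_(i < l) (g (m + i)%N - g i).
Proof.
rewrite !sumrB; apply/eqP; rewrite subr_eq addrAC eq_sym subr_eq.
have S a b : \sum_(i < a) g i + \sum_(i < b) g (a + i)%N = \sum_(i < a + b) g i.
  by rewrite big_split_ord.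
by rewrite [_ + \sum_(i < m) _]addrC S [_ + \sum_(i < l) _]addrC S addnC.
Qed.

End AlternatingBinomialSums.

(** * Estimates for cosine families *)

Section CosineFamily.
Variables (R : realType) (X : normedModType R[i]) (C : R -> {linear X -> X}).
Hypothesis cosC : cosine_family C.
Implicit Types (x y : X) (s t : R).

Lemma cosineN t x : C (- t) x = C t x.
Proof.
wlog t0 : t / 0 <= t.
  move=> cN; have [/cN //|/ltW t0] := leP 0 t.
  by have := cN (- t); rewrite opprK oppr_ge0 => ->.
have := cosineD cosC (lexx 0) t0 x.
by rewrite (cosine0 cosC) add0r sub0r scaler_nat mulr2n => /addrI.
Qed.

Lemma cosine_norm t x : C `|t| x = C t x.
Proof.
by have [t0|/ltW t0] := leP 0 t; rewrite ?(ger0_norm t0) ?(ler0_norm t0) ?cosineN.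
Qed.

(** The axiom applies to [|t|] and [|s|]; changing the sign of [t] or [s] only permutes [t + s] and
    [t - s] up to sign, which evenness absorbs. *)
Lemma cosine_mul2 t s x : C t (C s x) *+ 2 = C (t + s) x + C (t - s) x.
Proof.
have E : C `|t| (C `|s| x) *+ 2 = C (`|t| + `|s|) x + C (`|t| - `|s|) x.
  by rewrite -scaler_nat (cosineD cosC).
move: E; rewrite !cosine_norm => ->.
have [t0|/ltW t0] := leP 0 t; have [s0|/ltW s0] := leP 0 s;
  rewrite ?(ger0_norm t0) ?(ger0_norm s0) ?(ler0_norm t0) ?(ler0_norm s0) //.
- by rewrite opprK addrC.
- have -> : - t + s = - (t - s) by ring.
  have -> : - t - s = - (t + s) by ring.
  by rewrite !cosineN addrC.
- have -> : - t + - s = - (t + s) by ring.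
  have -> : - t - - s = - (t - s) by ring.
  by rewrite !cosineN.
Qed.

(* The binomial sum is [(2 (C s - 1)) ^ n y] written out through the addition formula. *)
Lemma ler_altbin_cosine n r s y : 0 <= r ->
  (forall z, rnorm (C s z - z) <= r * rnorm z) ->
  rnorm (altbin n.*2 (fun j => C (j%:R * s - n%:R * s) y)) <=
  (2 * r) ^+ n * rnorm y.
Proof.
move=> r0 Cr; elim: n y => [|n IHn] y.
  by rewrite /altbin big_ord1 !expr0 mul1r !mul0r subr0 (cosine0 cosC) scale1r bin0.
rewrite doubleS altbinSS exprSr -mulrA.
apply: le_trans (_ : (2 * r) ^+ n * rnorm ((C s y - y) *+ 2) <= _); last first.
  by rewrite ler_wpM2l ?exprn_ge0 ?mulr_ge0 // rnormMn -mulrA ler_wpM2l.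
apply: le_trans (IHn _); rewrite le_eqVlt; apply/orP; left; apply/eqP.
congr (rnorm (altbin _ _)); apply/funext => j; set u := j%:R * s - n%:R * s.
rewrite [RHS]raddfMn [in RHS]raddfB /= mulrnBl cosine_mul2.
have -> : j.+1%:R * s - n.+1%:R * s = u by rewrite /u -!natr1; ring.
have -> : j%:R * s - n.+1%:R * s = u - s by rewrite /u -!natr1; ring.
have -> : j.+2%:R * s - n.+1%:R * s = u + s by rewrite /u -!natr1; ring.
by rewrite [C (u + s) y + _]addrC [RHS]addrAC.
Qed.

(** The addition formula writes twice the sum as increments, over [l] indices, of a progression [g]
    rising from [t] minus those of a progression [h] descending from [t + b]. By [sum_shiftB] each
    telescopes to [l] differences, whatever [m] is. *)
Lemma ler_sum_cosine_increment m k l t a x B : 0 <= a ->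
  (forall s, `|s| <= `|t| + (k * (m + l))%:R * a -> rnorm (C s x) <= B) ->
  rnorm (\sum_(i < m) C ((k * i)%:R * a) (C (t + (k * l)%:R * a) x - C t x))
    <= (2 * l)%:R * B.
Proof.
move=> a0 CB; set b := (k * l)%:R * a.
pose g i := C (t + (k * i)%:R * a) x.
pose h i := C (t + b - (k * i)%:R * a) x.
have lerg i : (i < m + l)%N -> (k * i)%:R * a <= (k * (m + l))%:R * a.
  by move=> im; rewrite ler_wpM2r // ler_nat leq_mul // ltnW.
have sg i : (i < m + l)%N -> rnorm (g i) <= B.
  move=> im; apply: CB; rewrite (le_trans (ler_normD _ _)) // lerD2l.
  by rewrite ger0_norm ?lerg // mulr_ge0.
have sh i : (i < m + l)%N -> rnorm (h i) <= B.
  move=> im; apply: CB; rewrite -addrA (le_trans (ler_normD _ _)) // lerD2l.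
  have := lerg _ im; rewrite /b !natrM natrD.
  have := mulr_ge0 (mulr_ge0 (ler0n R k) (ler0n R l)) a0.
  have := mulr_ge0 (mulr_ge0 (ler0n R k) (ler0n R i)) a0.
  have := mulr_ge0 (mulr_ge0 (ler0n R k) (ler0n R m)) a0.
  by move=> *; rewrite ler_norml; apply/andP; split; lra.
have tel (f : nat -> X) : (forall i, (i < m + l)%N -> rnorm (f i) <= B) ->
    rnorm (\sum_(i < m) (f (l + i)%N - f i)) <= (2 * l)%:R * B.
  move=> fB; rewrite sum_shiftB (le_trans (ler_rnorm_sum _ _ _)) //.
  apply: (le_trans (ler_sum _ (_ : forall i, _ -> _ <= B + B))).
    move=> i _; rewrite (le_trans (ler_rnormB _ _)) // lerD // fB //.
      by rewrite ltn_add2l.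
    by rewrite ltn_addl.
  by rewrite sumr_const card_ord -mulr2n -mulrnA mulr_natl.
rewrite -(@ler_pM2l _ 2) // -rnormMn.
have -> : (\sum_(i < m) C ((k * i)%:R * a) (C (t + b) x - C t x)) *+ 2 =
    \sum_(i < m) (g (l + i)%N - g i) - \sum_(i < m) (h (l + i)%N - h i).
  rewrite -sumrMnl -sumrB; apply: eq_bigr => i _.
  rewrite raddfB /= mulrnBl !cosine_mul2 /g /h.
  set c := _ * a.
  have -> : (k * (l + i))%:R * a = b + c by rewrite mulnDr natrD mulrDl.
  have -> : t + b - (b + c) = - (c - t) by ring.
  have -> : t + b - c = - (c - (t + b)) by ring.
  have -> : t + (b + c) = c + (t + b) by ring.
  by rewrite !cosineN [t + c]addrC [- (C _ _ + _)]opprD [LHS]addrACA [- (_ - _) in RHS]opprB.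
by rewrite (le_trans (ler_rnormB _ _)) // mulrDl mul1r lerD // tel.
Qed.

Lemma ler_cosine_shift n m r t a x B : 0 <= r -> 0 <= a ->
  (forall s, 0 <= s <= m%:R * a -> forall z, rnorm (C s z - z) <= r * rnorm z) ->
  (forall s, `|s| <= `|t| + (n * m + n`!)%:R * a -> rnorm (C s x) <= B) ->
  ('C(n.*2, n)%:R - (2 * r) ^+ n) * (m%:R * rnorm (C (t + n`!%:R * a) x - C t x))
    <= 4 ^+ n * ((2 * n`!)%:R * B).
Proof.
move=> r0 a0 Cr CB; set y := _ - C t x.
have B0 : 0 <= B.
  by apply: le_trans (CB t _); rewrite ?rnorm_ge0 // lerDl mulr_ge0.
(* [Z j] collects the [j]-th terms over all sample points; at [j = n] the time vanishes, leaving [m]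
   copies of [y]. *)
pose Z j := \sum_(i < m) C (j%:R * (i%:R * a) - n%:R * (i%:R * a)) y.
have Zn : Z n = y *+ m.
  rewrite /Z; under eq_bigr do rewrite subrr (cosine0 cosC).
  by rewrite sumr_const card_ord.
have ZB j : (j < n.*2.+1)%N -> j != n -> rnorm (Z j) <= (2 * n`!)%:R * B.
  (* By evenness only [k = |j - n|] matters. It lies between 1 and [n], hence divides [n!], so the
     shift [n! a] is a whole number [l] of steps [k a]. *)
  move=> j2n jn; have [k [k0 kn Ck]] : exists k, [/\ (0 < k)%N, (k <= n)%N &
      forall c, C (j%:R * c - n%:R * c) y = C (k%:R * c) y].
    case: (ltngtP j n) jn => // [jn|nj] _.
      exists (n - j)%N; split; [lia | lia | move=> c].
      by rewrite -[RHS]cosineN natrB ?(ltnW jn) //; congr (C _ y); ring.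
    exists (j - n)%N; split; [lia | lia | move=> c].
    by rewrite natrB ?(ltnW nj) //; congr (C _ y); ring.
  have kdvd : (k %| n`!)%N by rewrite dvdn_fact // k0.
  have kl := divnK kdvd; set l := (n`! %/ k)%N in kl.
  have ln : (l <= n`!)%N by rewrite leq_div.
  apply: le_trans (_ : (2 * l)%:R * B <= _); last first.
    by rewrite ler_wpM2r // ler_nat leq_mul2l.
  rewrite /Z; under eq_bigr do rewrite Ck mulrA -natrM.
  rewrite /y -kl mulnC; apply: ler_sum_cosine_increment => // s Hs.
  apply: CB; apply: le_trans Hs _; rewrite lerD2l ler_wpM2r // ler_nat.
  by rewrite mulnDr [(k * l)%N]mulnC kl leq_add2r leq_mul2r kn orbT.
have := ler_rnorm_sum (index_enum 'I_m) predT
  (fun i => altbin n.*2 (fun j => C (j%:R * (i%:R * a) - n%:R * (i%:R * a)) y)).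
set S := \sum_(i < m) altbin _ _ => leS.
have {}leS : rnorm S <= m%:R * ((2 * r) ^+ n * rnorm y).
  have -> : m%:R * ((2 * r) ^+ n * rnorm y) =
      \sum_(i < m) (2 * r) ^+ n * rnorm y.
    by rewrite sumr_const card_ord mulr_natl.
  apply: le_trans leS _; apply: ler_sum => i _; apply: ler_altbin_cosine => // z; apply: Cr.
  by rewrite mulr_ge0 // ler_wpM2r // ler_nat ltnW.
have SE : S = \sum_(j < n.*2.+1) (-1) ^+ j *: (Z j *+ 'C(n.*2, j)).
  rewrite /S /altbin exchange_big; apply: eq_bigr => j _.
  by rewrite -scaler_sumr -sumrMnl.
have nn : (n < n.*2.+1)%N by rewrite ltnS -addnn leq_addr.
rewrite (bigD1 (Ordinal nn)) //= Zn in SE; set rest := \sum_(_ < _ | _) _ in SE.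
have leR : rnorm rest <= 4 ^+ n * ((2 * n`!)%:R * B).
  (* The total weight of row [2n]; the central coefficient, absent from [rest], is put back as a
     nonnegative summand. *)
  have -> : (4 : R) ^+ n = (\sum_(j < n.*2.+1) 'C(n.*2, j))%:R.
    have := expnDn 1 1 n.*2; under eq_bigr do rewrite !exp1n !muln1.
    by move=> <-; rewrite -mul2n expnM natrX.
  rewrite natr_sum mulr_suml (le_trans (ler_rnorm_sum _ _ _)) //.
  rewrite [leRHS](bigD1 (Ordinal nn)) //= ler_wpDl ?mulr_ge0 //.
  apply: ler_sum => j jn; rewrite rnorm_sign rnormMn ler_wpM2l // ZB //.
have : rnorm (S - rest) <= rnorm S + rnorm rest by exact: ler_rnormB.
rewrite SE addrK -SE rnorm_sign !rnormMn => H.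
rewrite mulrBl lerBlDl; apply: le_trans H _; apply: lerD => //.
by rewrite mulrCA.
Qed.

(** The doubling formula [C s = 2 C (s / 2) ^ 2 - 1] carries a bound [M] to [2 M ^ 2 + 1] on an
    interval twice as long, starting from [r + 1] on [[-d, d]]. *)
Lemma cosine_locally_bounded d r : 0 <= r -> 0 < d ->
  (forall s, 0 <= s <= d -> forall z, rnorm (C s z - z) <= r * rnorm z) ->
  forall T, exists2 M, 0 <= M &
    forall s x, `|s| <= T -> rnorm (C s x) <= M * rnorm x.
Proof.
move=> r0 d0 Cr T; have [k Tk] : exists k, T <= 2 ^+ k * d.
  exists (Num.trunc (T / d)).+1; rewrite -ler_pdivrMr //.
  apply: le_trans (ltW (truncnS_gt _)) _.
  by rewrite -natrX ler_nat ltnW // ltn_expl.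
elim: k T Tk => [|k IHk] T Tk.
  exists (r + 1) => [|s x sT]; first by rewrite addr_ge0.
  rewrite -cosine_norm -(subrK x (C `|s| x)) mulrDl mul1r.
  rewrite (le_trans (ler_rnormD _ _)) // lerD2r Cr // normr_ge0.
  by rewrite (le_trans sT) // -(mul1r d) -[X in X * _](expr0 2).
have [M M0 CM] := IHk (2 ^+ k * d) (lexx _).
exists (2 * M * M + 1) => [|s x sT]; first by rewrite addr_ge0 // !mulr_ge0.
have s2 : `|s / 2| <= 2 ^+ k * d.
  rewrite normrM [`|2^-1|]gtr0_norm ?invr_gt0 // ler_pdivrMr //.
  by rewrite (le_trans sT) // (le_trans Tk) // exprS -mulrA mulrC.
have -> : C s x = C (s / 2) (C (s / 2) x) *+ 2 - x.
  by rewrite cosine_mul2 subrr (cosine0 cosC) addrK -splitr.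
rewrite (le_trans (ler_rnormB _ _)) // mulrDl mul1r lerD2r rnormMn.
by rewrite -!mulrA ler_wpM2l // (le_trans (CM _ _ s2)) // ler_wpM2l // CM.
Qed.

Lemma cosine_equicontinuous d r : 0 <= r -> r < 2 -> 0 < d ->
  (forall s, 0 <= s <= d -> forall z, rnorm (C s z - z) <= r * rnorm z) ->
  forall T e, 0 < e -> exists2 h, 0 < h & forall t u x, `|t| <= T -> 0 <= u <= h ->
    rnorm (C (t + u) x - C t x) <= e * rnorm x.
Proof.
move=> r0 r2 d0 Cr T e e0.
have [n rn] := exists_central_bin_gt r0 r2.
have f0 : 0 < n`!%:R :> R by rewrite ltr0n fact_gt0.
(* The times met by [ler_cosine_shift] are at most [T + n (m a) + n! a], and both [m a] and [a] will
   be at most [d]. *)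
have [M M0 CM] := cosine_locally_bounded r0 d0 Cr (T + (n + n`!)%:R * d).
pose D := 'C(n.*2, n)%:R - (2 * r) ^+ n; have D0 : 0 < D by rewrite subr_gt0.
(* Dividing the bound of [ler_cosine_shift] by [D m] leaves [K / m], which the choice of [m] brings
   below [e]. *)
pose K := 4 ^+ n * ((2 * n`!)%:R * M) / D.
pose m := (Num.trunc (K / e)).+1.
have m0 : 0 < m%:R :> R by rewrite ltr0n.
have Km : K <= m%:R * e by rewrite -ler_pdivrMr //; apply/ltW/truncnS_gt.
(* For [u <= h] the step [a = u / n!] satisfies [m a <= d], so all sample points stay where
   [C s - 1] is controlled. *)
exists (n`!%:R * (d / m%:R)) => [|t u x tT /andP[u0 uh]].
  by rewrite mulr_gt0 // divr_gt0.
pose a := u / n`!%:R.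
have a0 : 0 <= a by rewrite divr_ge0 // ltW.
have ad : m%:R * a <= d by rewrite mulrC -ler_pdivlMr // ler_pdivrMr // mulrC.
have a1 : a <= d by apply: le_trans ad; rewrite ler_peMl // ler1n.
have uE : u = n`!%:R * a by rewrite mulrC divfK // gt_eqF.
have := @ler_cosine_shift n m r t a x (M * rnorm x) r0 a0.
have H1 s : 0 <= s <= m%:R * a -> forall z, rnorm (C s z - z) <= r * rnorm z.
  by move=> /andP[s0 sm]; apply: Cr; rewrite s0 (le_trans sm).
have H2 s : `|s| <= `|t| + (n * m + n`!)%:R * a -> rnorm (C s x) <= M * rnorm x.
  move=> sb; apply: CM; rewrite (le_trans sb) // lerD // !natrD !mulrDl natrM.
  by rewrite -mulrA lerD // ler_wpM2l.
move=> /(_ H1 H2); rewrite -uE -/D => H.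
have x0 := rnorm_ge0 x.
rewrite -(ler_pM2l m0) mulrA; apply: le_trans (_ : K * rnorm x <= _); last first.
  by rewrite ler_wpM2r.
rewrite /K -(ler_pM2l D0); apply: le_trans H _.
by rewrite le_eqVlt; apply/orP; left; apply/eqP; field; rewrite gt_eqF.
Qed.

End CosineFamily.

(** * Operator norm and pointwise bounds *)

Section OperatorNorm.
Variables (R : realType) (X : normedModType R[i]).
Implicit Types (f : X -> X) (a : R).

Lemma opnorm_ge0 f : (0 <= opnorm f)%E.
Proof.
apply: le_trans (ereal_sup_ubound _); last by exists 0; rewrite //= rnorm0.
by rewrite lee_fin rnorm_ge0.
Qed.

Lemma opnorm_le f a : 0 <= a -> (forall x, rnorm (f x) <= a * rnorm x) ->
  (opnorm f <= a%:E)%E.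
Proof.
move=> a0 fa; apply: ge_ereal_sup => _ [x /= x1 <-].
by rewrite lee_fin (le_trans (fa x)) // ler_piMr.
Qed.

Lemma rnorm_le_opnorm f a : scalable f -> (opnorm f <= a%:E)%E ->
  forall x, rnorm (f x) <= a * rnorm x.
Proof.
move=> fZ fa x; have [x0|x0] := eqVneq (rnorm x) 0.
  by rewrite (rnorm_eq0 x0) -(scale0r (0 : X)) fZ !scale0r rnorm0 mulr0.
have xp : 0 < rnorm x by rewrite lt_neqAle eq_sym x0 rnorm_ge0.
have ix : 0 <= (rnorm x)^-1 by rewrite invr_ge0 rnorm_ge0.
rewrite -ler_pdivrMr // mulrC -rnormZ // -fZ -lee_fin; apply: le_trans fa.
by apply: ereal_sup_ubound; exists ((rnorm x)^-1%:C%C *: x) => //=; rewrite rnormZ // mulVf.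
Qed.

End OperatorNorm.

Theorem corollary4p2 (R : realType) (X : completeNormedModType R[i])
    (C : R -> {linear X -> X}) :
  UMD X ->
  cosine_family C ->
  strongly_continuous C ->
  (limf_esup (fun t : R => opnorm (fun x => C t x - x)%R) 0^'+ < 2%:E)%E ->
  uniformly_continuous C /\
  limf_esup (fun t : R => opnorm (fun x => C t x - x)%R) 0^'+ = 0%E.
Proof.
move=> _ cosC _ /ereal_inf_lt[_ [V V0 <-] V2].
(* The supremum over [V] is an extended real below 2: a finite one is raised to at least 0, and
   [-oo] is replaced by 0. *)
have [r [r0 r2 Vr]] : exists r : R, [/\ 0 <= r, r < 2 &
    forall s, V s -> (opnorm (fun x => C s x - x)%R <= r%:E)%E].
  have Vs s : V s -> (opnorm (fun x => C s x - x)%R <=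
      ereal_sup [set opnorm (fun x => C t x - x)%R | t in V])%E.
    by move=> Vs; apply: ereal_sup_ubound; exists s.
  case: ereal_sup V2 Vs => [b|//|] b2 Vs.
    exists (Num.max b 0); split; first by rewrite le_max lexx orbT.
      by rewrite gt_max -lte_fin b2 ltr0n.
    by move=> s /Vs /le_trans; apply; rewrite lee_fin le_max lexx.
  by exists 0; split => // s /Vs /le_trans; apply; rewrite leNye.
have [d d0 Cr] : exists2 d : R, 0 < d & forall s, 0 <= s <= d ->
    forall z, rnorm (C s z - z) <= r * rnorm z.
  (* Halving [d] fits a closed interval into the open ball; [s = 0], which the right-sided filter
     leaves out, is treated apart. *)
  case: V0 => d /= d0 Vd; exists (d / 2) => [|s /andP[s0 sd] z].
    by rewrite divr_gt0.
  have [->|s1] := eqVneq s 0.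
    by rewrite (cosine0 cosC) subrr rnorm0 mulr_ge0 // rnorm_ge0.
  have sp : 0 < s by rewrite lt_neqAle eq_sym s1.
  apply: (@rnorm_le_opnorm _ _ (fun x => C s x - x)).
    by move=> k x; rewrite linearZ /= scalerBr.
  apply/Vr/Vd => //=; rewrite sub0r normrN gtr0_norm //.
  by apply: le_lt_trans sd _; rewrite ltr_pdivrMr // ltr_pMr // ltr1n.
have equi := cosine_equicontinuous cosC r0 r2 d0 Cr.
split.
  move=> t.
  have near_le e : 0 < e ->
      \forall s \near t, (opnorm (fun x => C s x - C t x)%R <= e%:E)%E.
    (* The smaller of [s] and [t] will serve as base point; [|t| + 1] bounds it even when it is
       [s]. *)
    move=> e0; have [h h0 Ch] := equi (`|t| + 1) e e0.
    near=> s; apply: opnorm_le => [|x]; first exact: ltW.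
    have st1 : `|t - s| <= 1 by near: s; exact: cvgr_dist_le.
    have sth : `|t - s| <= h by near: s; exact: cvgr_dist_le.
    have [ts|/ltW st] := leP t s.
      rewrite -{1}(subrKC t s); apply: Ch; first by rewrite lerDl.
      by rewrite subr_ge0 ts /= -(ger0_norm (_ : 0 <= s - t)) ?subr_ge0 // distrC.
    rewrite -rnormN opprB -{1}(subrKC s t); apply: Ch.
      by rewrite -[s in `|s|](subKr t) (le_trans (ler_normB _ _)) // lerD2l.
    by rewrite subr_ge0 st /= -(ger0_norm (_ : 0 <= t - s)) ?subr_ge0.
  apply/fine_cvgP; split.
    near=> s; rewrite ge0_fin_numE ?opnorm_ge0 //.
    apply: le_lt_trans (ltry 1); near: s; exact: near_le.
  apply/cvgrPdist_le => e e0; near=> s.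
  have le_e : (opnorm (fun x => C s x - C t x)%R <= e%:E)%E.
    by near: s; exact: near_le.
  rewrite sub0r normrN ger0_norm ?fine_ge0 ?opnorm_ge0 //.
  by rewrite -lee_fin fineK // ge0_fin_numE ?opnorm_ge0 // (le_lt_trans le_e) ?ltry.
apply/eqP; rewrite eq_le; apply/andP; split; last first.
  apply: limf_esup_ge0 => [|s]; last exact: opnorm_ge0.
  exact: filter_not_empty.
apply/lee_addgt0Pr => e e0; rewrite add0e.
(* Base point 0 suffices, since [C (0 + s) x - C 0 x] is [C s x - x]. *)
have [h h0 Ch] := equi 0 e e0.
apply: le_trans (ereal_inf_lbound _) _.
  exists [set s : R | 0 <= s <= h] => //; near=> s; apply/andP; split; near: s.
    exact: nbhs_right_ge.
  exact: nbhs_right_le.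
apply: ge_ereal_sup => _ [s /= sh <-]; apply: opnorm_le => [|x]; first exact: ltW.
by have := Ch 0 s x; rewrite normr0 add0r (cosine0 cosC); apply.
Unshelve. all: by end_near.
Qed.
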